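(* Let $(\mathcal{A},\mathcal{B},\mathcal{C})$ be a recollement of abelian categories, with functors $i:\mathcal{A}\to\mathcal{B}$, $q,p:\mathcal{B}\to\mathcal{A}$, $e:\mathcal{B}\to\mathcal{C}$ and $l,r:\mathcal{C}\to\mathcal{B}$. Let $M$ and $N$ be objects of $\mathcal{C}$. Then: (1) $N$ is $M$-CS-Rickart in $\mathcal{C}$ if and only if $r(N)$ is $r(M)$-CS-Rickart in $\mathcal{B}$. (2) $N$ is dual $M$-CS-Rickart in $\mathcal{C}$ if and only if $l(N)$ is dual $l(M)$-CS-Rickart in $\mathcal{B}$.
   Context: In an abelian category: a morphism $s:A\to B$ is a section (resp. $r:A\to B$ is a retraction) if there is $s':B\to A$ with $s's=1_A$ (resp. $r':B\to A$ with $rr'=1_B$). A monomorphism $f:X\to Y$ is essential if for every morphism $h:Y\to P$ such that $hf$ is a monomorphism, $h$ is a monomorphism. An epimorphism $f:X\to Y$ is superfluous if for every morphism $h:P\to X$ such that $fh$ is an epimorphism, $h$ is an epimorphism. For objects $M,N$ of an abelian category: $N$ is $M$-CS-Rickart if for every morphism $f:M\to N$ there are an essential monomorphism $u:\mathrm{Ker}(f)\to L$ and a section $s:L\to M$ with $\ker(f)=su$. $N$ is dual $M$-CS-Rickart if for every morphism $f:M\to N$ there are a retraction $\rho:N\to P$ and a superfluous epimorphism $t:P\to \mathrm{Coker}(f)$ with $\mathrm{coker}(f)=t\rho$. A recollement $(\mathcal{A},\mathcal{B},\mathcal{C})$ of abelian categories consists of additive functors $i:\mathcal{A}\to\mathcal{B}$,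 $q,p:\mathcal{B}\to\mathcal{A}$, $e:\mathcal{B}\to\mathcal{C}$, $l,r:\mathcal{C}\to\mathcal{B}$ such that: (i) $(l,e,r)$ is an adjoint triple; (ii) $(q,i,p)$ is an adjoint triple; (iii) $i$, $l$ and $r$ are fully faithful; (iv) $\mathrm{Im}(i)=\mathrm{Ker}(e)$, where $\mathrm{Im}(i)$ is the essential image of $i$ and $\mathrm{Ker}(e)$ consists of all objects $B$ of $\mathcal{B}$ with $e(B)=0$. An adjoint triple $(L,F,R)$ means that $L$ is left adjoint to $F$ and $F$ is left adjoint to $R$. *)

(* Defs.v *)
From mathcomp Require Import all_boot ssralg.
From mathcomp Require Import boolp.

Set Implicit Arguments.
Unset Strict Implicit.
Unset Printing Implicit Defensive.

Import GRing.Theory.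
Local Open Scope ring_scope.

Declare Scope cat_scope.
Open Scope cat_scope.
Reserved Notation "g ∘ f" (at level 40, left associativity).

Record preadditive := Preadditive {
  obj :> Type;
  hom : obj -> obj -> zmodType;
  idm : forall X, hom X X;
  comp : forall X Y Z, hom Y Z -> hom X Y -> hom X Z;
  compA : forall W X Y Z (h : hom Y Z) (g : hom X Y) (f : hom W X),
    comp h (comp g f) = comp (comp h g) f;
  comp1m : forall X Y (f : hom X Y), comp (idm Y) f = f;
  compm1 : forall X Y (f : hom X Y), comp f (idm X) = f;
  compDl : forall X Y Z (g1 g2 : hom Y Z) (f : hom X Y),
    comp (g1 + g2) f = comp g1 f + comp g2 f;
  compDr : forall X Y Z (g : hom Y Z) (f1 f2 : hom X Y),
    comp g (f1 + f2) = comp g f1 + comp g f2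
}.

Arguments hom {p} X Y : rename.
Arguments idm {p} X : rename.
Arguments comp {p X Y Z} g f : rename.
Notation "g ∘ f" := (comp g f) : cat_scope.

Section Morphisms.
Context {C : preadditive}.
Implicit Types X Y Z : C.

Definition is_mono X Y (f : hom X Y) : Prop :=
  forall Z (g h : hom Z X), f ∘ g = f ∘ h -> g = h.

Definition is_epi X Y (f : hom X Y) : Prop :=
  forall Z (g h : hom Y Z), g ∘ f = h ∘ f -> g = h.

Definition is_section X Y (s : hom X Y) : Prop :=
  exists s' : hom Y X, s' ∘ s = idm X.

Definition is_retraction X Y (r : hom X Y) : Prop :=
  exists r' : hom Y X, r ∘ r' = idm Y.

Definition isomorphic X Y : Prop :=
  exists (f : hom X Y) (g : hom Y X), g ∘ f = idm X /\ f ∘ g = idm Y.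

(* [Z] is terminal and initial; the hom-groups are never empty, so only the
   uniqueness of morphisms to and from [Z] has to be required. *)
Definition is_zero Z : Prop :=
  (forall X (f g : hom X Z), f = g) /\ (forall X (f g : hom Z X), f = g).

Definition is_kernel X Y (f : hom X Y) K (k : hom K X) : Prop :=
  f ∘ k = 0 /\
  forall Z (h : hom Z X), f ∘ h = 0 -> exists! h' : hom Z K, k ∘ h' = h.

Definition is_cokernel X Y (f : hom X Y) Q (c : hom Y Q) : Prop :=
  c ∘ f = 0 /\
  forall Z (h : hom Y Z), h ∘ f = 0 -> exists! h' : hom Q Z, h' ∘ c = h.

Definition is_biproduct X Y P (i1 : hom X P) (i2 : hom Y P)
    (p1 : hom P X) (p2 : hom P Y) : Prop :=
  [/\ p1 ∘ i1 = idm X, p2 ∘ i2 = idm Y, p1 ∘ i2 = 0, p2 ∘ i1 = 0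
    & i1 ∘ p1 + i2 ∘ p2 = idm P].

Definition essential X Y (f : hom X Y) : Prop :=
  is_mono f /\ forall P (h : hom Y P), is_mono (h ∘ f) -> is_mono h.

Definition superfluous X Y (f : hom X Y) : Prop :=
  is_epi f /\ forall P (h : hom P X), is_epi (f ∘ h) -> is_epi h.

End Morphisms.

Record abelian := Abelian {
  base :> preadditive;
  ab_zero : exists Z : base, is_zero Z;
  ab_biproduct : forall X Y : base,
    exists (P : base) (i1 : hom X P) (i2 : hom Y P)
           (p1 : hom P X) (p2 : hom P Y), is_biproduct i1 i2 p1 p2;
  ab_kernel : forall (X Y : base) (f : hom X Y),
    exists (K : base) (k : hom K X), is_kernel f k;
  ab_cokernel : forall (X Y : base) (f : hom X Y),
    exists (Q : base) (c : hom Y Q), is_cokernel f c;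
  ab_normal : forall (X Y : base) (m : hom X Y), is_mono m ->
    exists (Z : base) (f : hom Y Z), is_kernel f m;
  ab_conormal : forall (X Y : base) (c : hom X Y), is_epi c ->
    exists (W : base) (f : hom W X), is_cokernel f c
}.

Section Kernels.
Context {C : abelian}.
Implicit Types X Y : C.

Definition Ker X Y (f : hom X Y) : C := sval (cid (ab_kernel f)).

Definition ker X Y (f : hom X Y) : hom (Ker f) X :=
  sval (cid (svalP (cid (ab_kernel f)))).

Lemma kerP X Y (f : hom X Y) : is_kernel f (ker f).
Proof. exact: (svalP (cid (svalP (cid (ab_kernel f))))). Qed.

Definition Coker X Y (f : hom X Y) : C := sval (cid (ab_cokernel f)).

Definition coker X Y (f : hom X Y) : hom Y (Coker f) :=
  sval (cid (svalP (cid (ab_cokernel f)))).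

Lemma cokerP X Y (f : hom X Y) : is_cokernel f (coker f).
Proof. exact: (svalP (cid (svalP (cid (ab_cokernel f))))). Qed.

(* [CS_Rickart M N] reads "N is M-CS-Rickart", and [dual_CS_Rickart M N] reads
   "N is dual M-CS-Rickart". *)
Definition CS_Rickart (M N : C) : Prop :=
  forall f : hom M N,
  exists (L : C) (u : hom (Ker f) L) (s : hom L M),
    [/\ essential u, is_section s & ker f = s ∘ u].

Definition dual_CS_Rickart (M N : C) : Prop :=
  forall f : hom M N,
  exists (P : C) (rho : hom N P) (t : hom P (Coker f)),
    [/\ is_retraction rho, superfluous t & coker f = t ∘ rho].

End Kernels.

Record additive_functor (C D : preadditive) := AdditiveFunctor {
  fobj :> C -> D;
  fmap : forall X Y : C, {additive hom X Y -> hom (fobj X) (fobj Y)};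
  fmap1 : forall X : C, fmap X X (idm X) = idm (fobj X);
  fmap_comp : forall (X Y Z : C) (g : hom Y Z) (f : hom X Y),
    fmap X Z (g ∘ f) = fmap Y Z g ∘ fmap X Y f
}.

Arguments fmap {C D} F {X Y} : rename.

Definition fully_faithful (C D : preadditive) (F : additive_functor C D) : Prop :=
  forall X Y : C, bijective (fmap F : hom X Y -> hom (F X) (F Y)).

Definition left_adjoint (C D : preadditive)
    (L : additive_functor C D) (F : additive_functor D C) : Prop :=
  exists phi : forall (X : C) (Y : D), hom (L X) Y -> hom X (F Y),
  [/\ forall X Y, bijective (phi X Y),
      forall (X X' : C) (Y : D) (a : hom X' X) (g : hom (L X) Y),
        phi X' Y (g ∘ fmap L a) = phi X Y g ∘ a
    & forall (X : C) (Y Y' : D) (b : hom Y Y') (g : hom (L X) Y),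
        phi X Y' (b ∘ g) = fmap F b ∘ phi X Y g].

Definition adjoint_triple (C D : preadditive) (L : additive_functor C D)
    (F : additive_functor D C) (R : additive_functor C D) : Prop :=
  left_adjoint L F /\ left_adjoint F R.

Record recollement (A B C : abelian)
    (i : additive_functor A B) (q p : additive_functor B A)
    (e : additive_functor B C) (l r : additive_functor C B) : Prop :=
  Recollement {
    rec_ler : adjoint_triple l e r;
    rec_qip : adjoint_triple q i p;
    rec_i_ff : fully_faithful i;
    rec_l_ff : fully_faithful l;
    rec_r_ff : fully_faithful r;
    rec_im_ker : forall X : B,
      (exists Y : A, isomorphic (i Y) X) <-> is_zero (e X)
  }.

(* Main.v *)
(** In an adjoint triple (l, e, r) with r fully faithful, r preserves kernels
    and e preserves monomorphisms.  The counit e r -> 1 is invertible, and both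
    r and e transfer factorizations of the form "essential monomorphism followed
    by a section" between k and r(k).  Since every morphism r(M) -> r(N) is of
    the form r(f), and its kernel is r(ker f), this gives (1).  Statement (2)
    is (1) in the opposite categories, where the triple becomes (r, e, l). *)
From mathcomp Require Import all_boot ssralg.
From mathcomp Require Import boolp.
Require Import Defs.

Set Implicit Arguments.
Unset Strict Implicit.
Unset Printing Implicit Defensive.

Import GRing.Theory.
Local Open Scope ring_scope.

Section Preadditive.
Context {C : preadditive}.
Implicit Types X Y Z : C.

Lemma comp0m X Y Z (f : hom X Y) : (0 : hom Y Z) ∘ f = 0.
Proof. by apply: (addrI (0 ∘ f)); rewrite -compDl !addr0. Qed.

Lemma mono_comp X Y Z (g : hom Y Z) (f : hom X Y) :
  is_mono g -> is_mono f -> is_mono (g ∘ f).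
Proof. by move=> mg mf W a b; rewrite -!compA => /mg/mf. Qed.

Lemma mono_left_inv X Y (f : hom X Y) (g : hom Y X) :
  g ∘ f = idm X -> is_mono f.
Proof.
by move=> gf Z a b /(congr1 (comp g)); rewrite !compA gf !comp1m.
Qed.

Lemma essential_comp_iso X Y Z (u : hom Y Z) (v : hom X Y) (w : hom Y X) :
  w ∘ v = idm X -> v ∘ w = idm Y -> essential u -> essential (u ∘ v).
Proof.
move=> wv vw [mu eu]; split; first exact: mono_comp (mono_left_inv wv).
move=> P h mhuv; apply: eu.
have -> : h ∘ u = h ∘ (u ∘ v) ∘ w by rewrite -!compA vw compm1.
exact: mono_comp (mono_left_inv vw).
Qed.

(** Stated for any morphism of a preadditive category, so that it applies to [fmap r k] as well as
    to a chosen kernel, and can be read in [op C]. *)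
Definition essential_in_summand X Y (k : hom X Y) : Prop :=
  exists (L : C) (u : hom X L) (s : hom L Y),
    [/\ essential u, is_section s & k = s ∘ u].

Lemma kernel_unique X Y (f : hom X Y) K K' (k : hom K X) (k' : hom K' X) :
    is_kernel f k -> is_kernel f k' ->
  exists (v : hom K K') (w : hom K' K),
    [/\ w ∘ v = idm K, v ∘ w = idm K' & k' ∘ v = k].
Proof.
move=> [fk kU] [fk' kU'].
have [v [k'v _]] := kU' _ _ fk; have [w [kw _]] := kU _ _ fk'.
exists v, w; split => //.
- have [z [_ zU]] := kU _ _ fk.
  by rewrite -(zU (w ∘ v)) ?compA ?kw // (zU (idm K)) ?compm1.
- have [z [_ zU]] := kU' _ _ fk'.
  by rewrite -(zU (v ∘ w)) ?compA ?k'v // (zU (idm K')) ?compm1.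
Qed.

(** This allows the chosen kernel of [fmap r f] to be exchanged for [fmap r (ker f)]. *)
Lemma essential_in_summand_kernel X Y (f : hom X Y) K K'
    (k : hom K X) (k' : hom K' X) :
  is_kernel f k -> is_kernel f k' ->
  essential_in_summand k' -> essential_in_summand k.
Proof.
move=> kf kf' [L [u [s [eu ss k'E]]]].
have [v [w [wv vw <-]]] := kernel_unique kf kf'.
exists L, (u ∘ v), s; split; rewrite ?k'E ?compA //.
exact: essential_comp_iso vw eu.
Qed.

End Preadditive.

Section RightAdjoint.
Context {C D : preadditive}.
Variables (L : additive_functor C D) (F : additive_functor D C).
Hypothesis adj : left_adjoint L F.

(** Naturality of [phi] turns composition with [fmap F f] into composition with [f] on
    transposes. *)
Lemma right_adjoint_mono X Y (f : hom X Y) : is_mono f -> is_mono (fmap F f).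
Proof.
have [phi [phi_bij phiL phiF]] := adj.
move=> mf Z g h; have [psi phiK psiK] := phi_bij Z X.
rewrite -(psiK g) -(psiK h) -!phiF => /(bij_inj (phi_bij Z Y)) /mf.
by move=> ->.
Qed.

Lemma right_adjoint_kernel X Y (f : hom X Y) K (k : hom K X) :
  is_kernel f k -> is_kernel (fmap F f) (fmap F k).
Proof.
have [phi [phi_bij phiL phiF]] := adj.
(* An adjunction here is a natural bijection of sets; that it preserves zero follows by factoring 0
   through 0 and using additivity of [F]. *)
have phi0 Z W : phi Z W 0 = 0.
  by rewrite -(comp0m W (0 : hom (L Z) W)) phiF raddf0 comp0m.
move=> [fk kU]; split; first by rewrite -fmap_comp fk raddf0.
move=> Z h; have [psi phiK psiK] := phi_bij Z X.
have [psi' phiK' psiK'] := phi_bij Z K.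
rewrite -(psiK h) -phiF -(phi0 Z Y) => /(bij_inj (phi_bij Z Y)) fh0.
have [h' [kh' h'U]] := kU _ _ fh0.
exists (phi _ _ h'); split; first by rewrite -phiF kh'.
move=> g; rewrite -(psiK' g) -phiF => /(bij_inj (phi_bij Z X)) kg.
by rewrite (h'U _ kg).
Qed.

End RightAdjoint.

Section AdjointTriple.
Context {B C : preadditive}.
Variables (l r : additive_functor C B) (e : additive_functor B C).
Hypotheses (ler : adjoint_triple l e r) (r_ff : fully_faithful r).

Lemma essential_in_summand_fmap K M (k : hom K M) :
  essential_in_summand k <-> essential_in_summand (fmap r k).
Proof.
have [le er] := ler; have [phi [phi_bij phiL phiF]] := er.
have phi_inj X Y := bij_inj (phi_bij X Y).
have counit Y : exists c, phi (r Y) Y c = idm (r Y).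
  by have [psi _ psiK] := phi_bij (r Y) Y; exists (psi (idm _)).
pose eps Y := sval (cid (counit Y)).
have phi_eps Y : phi (r Y) Y (eps Y) = idm (r Y) := svalP (cid (counit Y)).
have phi_epsL X Y (g : hom X (r Y)) : phi X Y (eps Y ∘ fmap e g) = g.
  by rewrite phiL phi_eps comp1m.
have epsL X Y (g : hom (e X) Y) : eps Y ∘ fmap e (phi X Y g) = g.
  exact/phi_inj/phi_epsL.
have phi_epsR X Y (g : hom X Y) : phi _ _ (g ∘ eps X) = fmap r g.
  by rewrite phiF phi_eps compm1.
have eps_nat X Y (g : hom X Y) : eps Y ∘ fmap e (fmap r g) = g ∘ eps X.
  by apply: phi_inj; rewrite phi_epsL phi_epsR.
(* By fullness of r, the unit at r Y is the image of an inverse of the counit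
   at Y. *)
have counit_inv Y : exists c : hom Y (e (r Y)),
    eps Y ∘ c = idm Y /\ c ∘ eps Y = idm _.
  have [ri _ riK] := r_ff Y (e (r Y)).
  pose c := ri (phi _ _ (idm (e (r Y)))); exists c.
  have cE : fmap r c = phi _ _ (idm _) by rewrite /c riK.
  split; last by apply: phi_inj; rewrite phi_epsR cE.
  apply: (bij_inj (r_ff _ _)).
  by rewrite fmap_comp cE -phiF compm1 phi_eps fmap1.
pose x Y := sval (cid (counit_inv Y)).
have eps_x Y : eps Y ∘ x Y = idm Y := (svalP (cid (counit_inv Y))).1.
have x_eps Y : x Y ∘ eps Y = idm _ := (svalP (cid (counit_inv Y))).2.
have x_nat X Y (g : hom X Y) : fmap e (fmap r g) ∘ x X = x Y ∘ g.
  rewrite -[LHS]comp1m -(x_eps Y) -compA (compA (eps Y)) eps_nat.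
  by rewrite -(compA g) eps_x compm1.
have e_mono X Y (f : hom X Y) := right_adjoint_mono le (f := f).
split=> [[L [u [s [[mu eu] [s' s's] kE]]]]|[L [u [s [[mu eu] [s' s's] kE]]]]].
- exists (r L), (fmap r u), (fmap r s); split.
  + split=> [|P h mhu]; first exact (right_adjoint_mono er mu).
    (* Essentiality of [u] is used on [fmap e h ∘ x L]: its composite with [u] is
       [fmap e (h ∘ fmap r u) ∘ x K]. Morphisms into [r L] are then compared through their
       transposes into [L]. *)
    have mhx : is_mono (fmap e h ∘ x L).
      apply: eu; rewrite -compA -x_nat compA -fmap_comp.
      exact: mono_comp (e_mono _ _ _ mhu) (mono_left_inv (eps_x K)).
    move=> Z a b hab; rewrite -(phi_epsL _ _ a) -(phi_epsL _ _ b).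
    congr (phi _ _ _); apply: mhx; rewrite -!compA !(compA (x L)) x_eps !comp1m.
    by rewrite -!fmap_comp hab.
  + by exists (fmap r s'); rewrite -fmap_comp s's fmap1.
  + by rewrite kE fmap_comp.
(* The image under [e] of the factorization of [fmap r k], corrected at both ends by the counit and
   its inverse. *)
- exists (e L), (fmap e u ∘ x K), (eps M ∘ fmap e s); split.
  + split=> [|P h mhu].
      exact: mono_comp (e_mono _ _ _ mu) (mono_left_inv (eps_x K)).
    (* Essentiality of [u] is used on the transpose of [h]: composed with [u] it is [r] of a
       monomorphism. Then [h] is recovered as [eps P ∘ fmap e (phi _ _ h)]. *)
    have mphi : is_mono (phi _ _ h).
      apply: eu; rewrite -phiL.
      have -> : h ∘ fmap e u = h ∘ (fmap e u ∘ x K) ∘ eps K.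
        by rewrite -!compA x_eps compm1.
      by rewrite phi_epsR; apply: (right_adjoint_mono er).
    rewrite -(epsL _ _ h).
    exact: mono_comp (mono_left_inv (x_eps P)) (e_mono _ _ _ mphi).
  + exists (fmap e s' ∘ x M).
    by rewrite -compA (compA (x M)) x_eps comp1m -fmap_comp s's fmap1.
  + by rewrite -compA (compA (fmap e s)) -fmap_comp -kE x_nat compA eps_x comp1m.
Qed.

Lemma essential_in_summand_ker M N (f : hom M N) K (k : hom K M)
    K' (k' : hom K' (r M)) :
  is_kernel f k -> is_kernel (fmap r f) k' ->
  essential_in_summand k <-> essential_in_summand k'.
Proof.
move=> /(right_adjoint_kernel ler.2) kf kf'.
rewrite essential_in_summand_fmap.
split; first exact: essential_in_summand_kernel kf' kf.
exact: essential_in_summand_kernel kf kf'.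
Qed.

End AdjointTriple.

Section Opposite.

Definition op (C : preadditive) : preadditive :=
  @Preadditive C (fun X Y => hom Y X) (fun X => idm X)
    (fun X Y Z g f => f ∘ g)
    (fun W X Y Z h g f => esym (compA f g h))
    (fun X Y f => compm1 f) (fun X Y f => comp1m f)
    (fun X Y Z g1 g2 f => compDr f g1 g2)
    (fun X Y Z g f1 f2 => compDl f1 f2 g).

Definition op_functor (C D : preadditive) (F : additive_functor C D) :
    additive_functor (op C) (op D) :=
  @AdditiveFunctor (op C) (op D) F (fun X Y => @fmap C D F Y X)
    (fun X => fmap1 F X) (fun X Y Z g f => fmap_comp F f g).

(** The inverse of [phi] is the adjunction bijection read backwards; its naturality follows from
    that of [phi] by injectivity. *)
Lemma left_adjoint_op (C D : preadditive)
    (L : additive_functor C D) (F : additive_functor D C) :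
  left_adjoint L F -> left_adjoint (op_functor F) (op_functor L).
Proof.
move=> [phi [phi_bij phiL phiF]].
have inv X Y : {psi | cancel (phi X Y) psi & cancel psi (phi X Y)}.
  by apply: cid2; have [psi] := phi_bij X Y; exists psi.
pose psi X Y := s2val (inv X Y).
have phiK X Y : cancel (phi X Y) (psi X Y) := s2valP (inv X Y).
have psiK X Y : cancel (psi X Y) (phi X Y) := s2valP' (inv X Y).
exists (fun (Y : op D) (X : op C) => psi X Y); split.
- by move=> Y X; exists (phi X Y).
- move=> Y Y' X b g; apply: (can_inj (phiK X Y')).
  by rewrite psiK /= phiF psiK.
- move=> Y X X' a g; apply: (can_inj (phiK X' Y)).
  by rewrite psiK /= phiL psiK.
Qed.

Lemma adjoint_triple_op (C D : preadditive) (L R : additive_functor C D)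
    (F : additive_functor D C) :
  adjoint_triple L F R ->
  adjoint_triple (op_functor R) (op_functor F) (op_functor L).
Proof. by move=> [LF FR]; split; apply: left_adjoint_op. Qed.

Lemma fully_faithful_op (C D : preadditive) (F : additive_functor C D) :
  fully_faithful F -> fully_faithful (op_functor F).
Proof. by move=> F_ff X Y; apply: (F_ff Y X). Qed.

(* Up to conversion, kernels, sections and essential monomorphisms of [op C] are
   cokernels, retractions and superfluous epimorphisms of [C]. *)
Lemma dual_CS_RickartE (C : abelian) (M N : C) :
  dual_CS_Rickart M N <->
  forall f : hom M N, @essential_in_summand (op C) _ _ (coker f).
Proof.
split=> H f; first by have [P [rho [t [? ? ?]]]] := H f; exists P, t, rho.
by have [P [t [rho [? ? ?]]]] := H f; exists P, rho, t.
Qed.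

End Opposite.

Theorem corollary4p7 (A B C : abelian)
    (i : additive_functor A B) (q p : additive_functor B A)
    (e : additive_functor B C) (l r : additive_functor C B)
    (rec : recollement i q p e l r) (M N : C) :
  (CS_Rickart M N <-> CS_Rickart (r M : B) (r N : B)) /\
  (dual_CS_Rickart M N <-> dual_CS_Rickart (l M : B) (l N : B)).
Proof.
have [ler _ _ l_ff r_ff _] := rec; split.
- have kerE (f : hom M N) :
      essential_in_summand (ker f) <-> essential_in_summand (ker (fmap r f)).
    exact: (essential_in_summand_ker ler r_ff (kerP f) (kerP _)).
  split=> H f; last exact/kerE/H.
  have [ri _ riK] := r_ff M N.
  by rewrite -(riK f); apply/kerE/H.
- have cokerE (f : hom M N) : @essential_in_summand (op C) _ _ (coker f) <->
      @essential_in_summand (op B) _ _ (coker (fmap l f)).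
    (* Here [op_functor l] is the right adjoint in the opposite triple, and [cokerP] is read by
       conversion as a kernel property. *)
    exact: (essential_in_summand_ker (adjoint_triple_op ler)
      (fully_faithful_op l_ff) (cokerP f) (cokerP _)).
  rewrite !dual_CS_RickartE; split=> H f; last exact/cokerE/H.
  have [li _ liK] := l_ff M N.
  by rewrite -(liK f); apply/cokerE/H.
Qed.
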